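(* Let $A\in\mathbb{R}^{n\times n}$, $B\in\mathbb{R}^{n\times m}$, $C\in\mathbb{R}^{p\times n}$, $D\in\mathbb{R}^{p\times m}$, and let $\Sigma$ be the system associated with $(A,B,C,D)$. Let $\lambda_1,\ldots,\lambda_h\in\mathbb{C}$ be distinct and disjoint from the invariant zeros of $\Sigma$. For each $i\in\{1,\ldots,h\}$ let $\begin{bmatrix} V_i \\ W_i \end{bmatrix}$ be a basis matrix for $\ker P_{\lambda_i}$, where $V_i$ has $n$ rows and $W_i$ has $m$ rows. Then $$\operatorname{rank}\,[\,V_1\;\;V_2\;\;\cdots\;\;V_h\,]=\dim(\mathcal{V}^\star\cap\mathcal{S}_h).$$
   Context: Let $\mathcal{X}=\mathbb{R}^n$, $\mathcal{U}=\mathbb{R}^m$, $\mathcal{Y}=\mathbb{R}^p$. The Rosenbrock (system) matrix pencil is $P_\lambda=\begin{bmatrix}A-\lambda I& B\\ C& D\end{bmatrix}$; its kernel at $\lambda\in\mathbb{C}$ and the rank in the claim are taken over $\mathbb{C}$. A basis matrix for a subspace is a matrix whose columns form a basis of it. A subspace $\mathcal{V}\subseteq\mathcal{X}$ is output-nulling if there exists $F\in\mathbb{R}^{m\times n}$ with $(A+BF)\mathcal{V}\subseteq\mathcal{V}\subseteq\ker(C+DF)$; such an $F$ is called a friend of $\mathcal{V}$. $\mathcal{V}^\star$ is the largest output-nulling subspace of $\mathcal{X}$. For an output-nulling subspace $\mathcal{V}$ with friend $F$, the reachability subspace on $\mathcal{V}$ is $\mathcal{R}_{\mathcal{V}}=\langle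 A+BF\,|\,\mathcal{V}\cap B\ker D\rangle$, the smallest $(A+BF)$-invariant subspace containing $\mathcal{V}\cap B\ker D$ (independent of the friend $F$); $\mathcal{R}^\star=\mathcal{R}_{\mathcal{V}^\star}$. The invariant zeros of $\Sigma$ are the eigenvalues of the map induced by $A+BF$ on $\mathcal{V}^\star/\mathcal{R}^\star$ for any friend $F$ of $\mathcal{V}^\star$ (equivalently, the $\lambda\in\mathbb{C}$ at which $P_\lambda$ loses rank with respect to its normal rank). The sequence $(\mathcal{S}_i)_{i\ge 0}$ is defined by $\mathcal{S}_0=\{0\}\subseteq\mathcal{X}$ and $\mathcal{S}_{i+1}=[\,A\;\;B\,]\big((\mathcal{S}_i\oplus\mathcal{U})\cap\ker[\,C\;\;D\,]\big)$ for $i\ge 0$. *)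

(* Defs.v *)
From HB Require Import structures.
From mathcomp Require Import all_boot all_order all_algebra.
From mathcomp Require Import complex.
From mathcomp Require Import boolp classical_sets reals.

Set Implicit Arguments.
Unset Strict Implicit.
Unset Printing Implicit Defensive.

Import GRing.Theory Num.Theory.
Local Open Scope ring_scope.
Local Open Scope complex_scope.

Definition cmul (K : fieldType) (q r : nat) (M : 'M[K]_(r, q)) :
    'Hom('cV[K]_q, 'cV[K]_r) :=
  linfun (mulmx M).

Definition basis_mx (K : fieldType) (q k : nat) (U : {vspace 'cV[K]_q})
    (M : 'M[K]_(q, k)) : bool :=
  basis_of U [tuple col j M | j < k].

Section Extremal.
Context (K : fieldType) (vT : vectType K).
Implicit Types (P : {vspace vT} -> Prop) (V W : {vspace vT}).

Definition is_largest P V := P V /\ forall W, P W -> (W <= V)%VS.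

Definition is_smallest P V := P V /\ forall W, P W -> (V <= W)%VS.

(* The default values 0 and fullv play no role where these are used below:
   see [vstarP] and [reachP]. *)
Definition largest P : {vspace vT} := xget 0%VS [set V | is_largest P V].

Definition smallest P : {vspace vT} := xget fullv [set V | is_smallest P V].

Lemma largestP P V0 : P V0 -> (forall V W, P V -> P W -> P (V + W)%VS) ->
  is_largest P (largest P).
Proof.
move=> P0 PD; apply: xgetPex => /=.
pose Q k := `[< exists2 V, P V & \dim V = k >].
have exQ : exists k, Q k by exists (\dim V0); apply/asboolP; exists V0.
have Qle k : Q k -> (k <= \dim {: vT})%N.
  by move=> /asboolP[V _ <-]; rewrite dimvS ?subvf.
case: (ex_maxnP exQ Qle) => k /asboolP[V PV dV] kmax.
exists V; split=> // W PW.
have /eqP -> : V == (V + W)%VS; last exact: addvSr.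
rewrite eqEdim addvSl dV kmax //; apply/asboolP.
by exists (V + W)%VS => //; apply: PD.
Qed.

Lemma smallestP P V0 : P V0 -> (forall V W, P V -> P W -> P (V :&: W)%VS) ->
  is_smallest P (smallest P).
Proof.
move=> P0 PI; apply: xgetPex => /=.
pose Q k := `[< exists2 V, P V & \dim V = k >].
have exQ : exists k, Q k by exists (\dim V0); apply/asboolP; exists V0.
case: (ex_minnP exQ) => k /asboolP[V PV dV] kmin.
exists V; split=> // W PW.
have /eqP <- : (V :&: W)%VS == V; last exact: capvSr.
rewrite eqEdim capvSl dV kmin //; apply/asboolP.
by exists (V :&: W)%VS => //; apply: PI.
Qed.

End Extremal.

Definition mx_of_end (K : fieldType) (q : nat) (f : 'End('cV[K]_q)) : 'M[K]_q :=
  \matrix_(i, j) f (delta_mx j 0) i 0.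

Lemma mx_of_endE (K : fieldType) q (f : 'End('cV[K]_q)) x :
  mx_of_end f *m x = f x.
Proof.
rewrite {2}[x]matrix_sum_delta linear_sum /=; apply/colP => i.
rewrite mxE summxE; apply: eq_bigr => j _.
by rewrite big_ord1 linearZ !mxE mulrC.
Qed.

Lemma Re_mulmx (R : realType) (q r : nat) (M : 'M[R]_(q, r)) (x : 'cV[R[i]]_r) :
  map_mx (@complex.Re R) (map_mx (real_complex R) M *m x) =
  M *m map_mx (@complex.Re R) x.
Proof.
apply/colP => i; rewrite !mxE raddf_sum; apply: eq_bigr => j _.
by rewrite !mxE; case: (x j 0) => a b /=; rewrite mul0r subr0.
Qed.

Lemma Im_mulmx (R : realType) (q r : nat) (M : 'M[R]_(q, r)) (x : 'cV[R[i]]_r) :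
  map_mx (@complex.Im R) (map_mx (real_complex R) M *m x) =
  M *m map_mx (@complex.Im R) x.
Proof.
apply/colP => i; rewrite !mxE raddf_sum; apply: eq_bigr => j _.
by rewrite !mxE; case: (x j 0) => a b /=; rewrite mul0r addr0.
Qed.

Section System.
Context (R : realType) (n m p : nat).
Context (A : 'M[R]_n) (B : 'M[R]_(n, m)) (C : 'M[R]_(p, n)) (D : 'M[R]_(p, m)).
Implicit Types (V W : {vspace 'cV[R]_n}) (F : 'M[R]_(m, n)) (lam : R[i]).

Definition friend V F : bool :=
  (cmul (A + B *m F) @: V <= V)%VS && (V <= lker (cmul (C + D *m F)))%VS.

Definition output_nulling V : Prop := exists F, friend V F.

Definition vstar : {vspace 'cV[R]_n} := largest output_nulling.

Definition reach V F : {vspace 'cV[R]_n} :=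
  smallest (fun W => (cmul (A + B *m F) @: W <= W)%VS /\
                     (V :&: (cmul B @: lker (cmul D)) <= W)%VS).

(* Membership in the complexification of V, the complex span of V. *)
Definition in_complexification V (x : 'cV[R[i]]_n) : bool :=
  (map_mx (@complex.Re R) x \in V) && (map_mx (@complex.Im R) x \in V).

(* For W <= V both M-invariant: the class of x in the complexification of V / W
   is an eigenvector, with eigenvalue lam, of the map induced by M. *)
Definition induced_eigenvalue (M : 'M[R]_n) V W lam : Prop :=
  exists x : 'cV[R[i]]_n,
    [/\ in_complexification V x, ~~ in_complexification W x &
        in_complexification W (map_mx (real_complex R) M *m x - lam *: x)].

(* The choice of the friend F is immaterial: see [invariant_zeroE]. *)
Definition invariant_zero lam : Prop :=
  exists2 F, friend vstar F &
    induced_eigenvalue (A + B *m F) vstar (reach vstar F) lam.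

Definition rosenbrock lam : 'M[R[i]]_(n + p, n + m) :=
  block_mx (map_mx (real_complex R) A - lam%:M) (map_mx (real_complex R) B)
           (map_mx (real_complex R) C) (map_mx (real_complex R) D).

Definition dsum_cV V (U : {vspace 'cV[R]_m}) : {vspace 'cV[R]_(n + m)} :=
  (cmul (col_mx 1%:M 0) @: V + cmul (col_mx 0 1%:M) @: U)%VS.

Fixpoint sseq (i : nat) : {vspace 'cV[R]_n} :=
  if i is j.+1 then
    (cmul (row_mx A B) @: (dsum_cV (sseq j) fullv :&: lker (cmul (row_mx C D))))%VS
  else 0%VS.

Lemma friendP V F : reflect
  (forall x, x \in V -> ((A + B *m F) *m x \in V) /\ (C + D *m F) *m x = 0)
  (friend V F).
Proof.
apply: (iffP andP) => [[/subvP AV /subvP CV] x xV | VF].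
  split; last by have := CV x xV; rewrite memv_ker lfunE => /eqP.
  by rewrite -[_ *m x](lfunE (mulmx (A + B *m F))) AV ?memv_img.
split; apply/subvP => x.
  by case/memv_imgP => y /VF[yV _] ->; rewrite lfunE.
by move=> /VF[_ Cx0]; rewrite memv_ker lfunE /= Cx0.
Qed.

Lemma output_nulling0 : output_nulling 0.
Proof.
by exists 0; apply/friendP => x; rewrite memv0 => /eqP ->; rewrite !mulmx0 mem0v.
Qed.

Lemma output_nullingD V W :
  output_nulling V -> output_nulling W -> output_nulling (V + W).
Proof.
move=> [F /friendP VF] [G /friendP WG].
pose H := F *m mx_of_end (addv_pi1 V W) + G *m mx_of_end (addv_pi2 V W).
exists H; apply/friendP => x xVW.
have [Av Cv] := VF _ (memv_pi1 V W x).
have [Aw Cw] := WG _ (memv_pi2 V W x).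
rewrite /H !mulmxDl !mulmxDr !mulmxDl !mulmxA -!(mulmxA _ (mx_of_end _)).
rewrite !mx_of_endE.
set v := addv_pi1 V W x in Av Cv *; set w := addv_pi2 V W x in Aw Cw *.
have xE : x = v + w by rewrite addv_pi1_pi2.
split.
  have -> : A *m x + (B *m F *m v + B *m G *m w) =
            (A + B *m F) *m v + (A + B *m G) *m w.
    by rewrite xE mulmxDr !mulmxDl addrACA.
  exact: memv_add.
have -> : C *m x + (D *m F *m v + D *m G *m w) =
          (C + D *m F) *m v + (C + D *m G) *m w.
  by rewrite xE mulmxDr !mulmxDl addrACA.
by rewrite Cv Cw addr0.
Qed.

Lemma vstarP : is_largest output_nulling vstar.
Proof. exact: largestP output_nulling0 output_nullingD. Qed.

Lemma reachP V F :
  is_smallest (fun W => (cmul (A + B *m F) @: W <= W)%VS /\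
                        (V :&: (cmul B @: lker (cmul D)) <= W)%VS) (reach V F).
Proof.
apply: (@smallestP _ _ _ fullv) => [|U W [AU EU] [AW EW]]; first by rewrite !subvf.
split; last by rewrite subv_cap EU.
rewrite subv_cap (subv_trans (limgS _ (capvSl U W)) AU).
by rewrite (subv_trans (limgS _ (capvSr U W)) AW).
Qed.

Lemma reach_subv V F : friend V F -> (reach V F <= V)%VS.
Proof.
by move=> /andP[VF _]; have [_] := reachP V F; apply; rewrite VF capvSl.
Qed.

(* Two friends of V differ, on V, by a map into the intersection of V with
   B ker D. *)
Lemma friend_diff V F G x : friend V F -> friend V G -> x \in V ->
  B *m (F - G) *m x \in reach V F.
Proof.
move=> /friendP VF /friendP VG xV.
have [Af Cf] := VF x xV; have [Ag Cg] := VG x xV.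
have [[_ /subvP sub] _] := reachP V F; apply: sub.
rewrite memv_cap; apply/andP; split.
  have -> : B *m (F - G) *m x = (A + B *m F) *m x - (A + B *m G) *m x.
    by rewrite -mulmxBl opprD addrACA subrr add0r mulmxBr.
  exact: memvB.
apply/memv_imgP; exists ((F - G) *m x); last by rewrite lfunE /= mulmxA.
rewrite memv_ker lfunE /= mulmxA mulmxBr mulmxBl.
have -> : D *m F *m x - D *m G *m x = (C + D *m F) *m x - (C + D *m G) *m x.
  by rewrite !mulmxDl opprD addrACA subrr add0r.
by rewrite Cf Cg subr0.
Qed.

Lemma reach_friend V F G : friend V F -> friend V G -> reach V F = reach V G.
Proof.
have sub F' G' : friend V F' -> friend V G' -> (reach V F' <= reach V G')%VS.
  move=> VF VG; have [[AG EG] _] := reachP V G'; have [_] := reachP V F'; apply.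
  split=> //; apply/subvP => _ /memv_imgP[x xR ->]; rewrite lfunE /=.
  have -> : A + B *m F' = (A + B *m G') - B *m (G' - F').
    by rewrite mulmxBr opprB addrACA subrr addr0.
  rewrite mulmxBl memvB //.
    rewrite -[_ *m x](lfunE (mulmx (A + B *m G'))).
    by apply: (subvP AG); apply: memv_img.
  by apply: friend_diff => //; apply: subvP (reach_subv VG) _ xR.
by move=> VF VG; apply/eqP; rewrite eqEsubv !sub.
Qed.

Lemma invariant_zeroE F lam : friend vstar F ->
  invariant_zero lam <->
  induced_eigenvalue (A + B *m F) vstar (reach vstar F) lam.
Proof.
move=> VF; split=> [[G VG]|]; last by exists F.
rewrite (reach_friend VG VF) => -[x [xV xR ExR]]; exists x; split=> //.
have -> : A + B *m F = (A + B *m G) + B *m (F - G).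
  by rewrite mulmxBr addrACA subrr addr0.
have /andP[rV iV] := xV; have /andP[rE iE] := ExR.
rewrite map_mxD mulmxDl addrAC /in_complexification.
rewrite (map_mxD (complex.Re (R:=R))) (map_mxD (complex.Im (R:=R))).
by rewrite Re_mulmx Im_mulmx !memvD // friend_diff.
Qed.

End System.

(* Main.v *)
Require Import Defs.
From mathcomp Require Import all_boot all_order all_algebra.
From mathcomp Require Import complex.
From mathcomp Require Import reals.
From mathcomp Require Import zify.

Set Implicit Arguments.
Unset Strict Implicit.
Unset Printing Implicit Defensive.

Import GRing.Theory Num.Theory.
Local Open Scope ring_scope.
Local Open Scope complex_scope.

(** Fix a friend F of V*, put T = A + BF and E = V* \cap B ker D, and let N(a)
    be the space of those x in V* with (T - a) x in E, everything being
    complexified.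

    On V* the system is the pair (T, E). Whenever (x, u) satisfies Cx + Du = 0
    and Ax + Bu lies in V*, maximality of V* puts x in V*, and then Ax + Bu
    differs from Tx by an element of E. On the kernel of P_a, where Ax + Bu =
    ax and the real span of Re x and Im x is output-nulling, this says that the
    columns of V_i span N(lam_i) ([mem_resolvent_rosenbrock]). Applied to the
    recursion defining S_i, it says that V* \cap S_i = E + TE + ... + T^(i-1) E
    ([vstar_cap_sseq]). So the claim becomes dim (N(lam_1) + ... + N(lam_h)) =
    dim (E + ... + T^(h-1) E). The two subspaces are different in general, only
    the dimensions agree.

    If lam is not an invariant zero, T - lam is injective, hence onto, on
    V*/R*. The space E + (T - lam) V* is T-invariant and contains E, hence it
    contains R*, and so it is all of V* ([not_zero_cover]). When Z is between E
    and V* it follows that the preimage of Z under T - lam, within V*, has the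
    same dimension as Z ([dim_preimv]), even where T - lam is singular: what is
    lost in the image is regained in the kernel.

    Finally write N(s) for the sum of the N(b), b in s, and K_i for E + ... +
    T^(i-1) E. For a not in s, the preimage of N(s) + K_(i+1) under T - a is
    N(a :: s) + K_i ([preim_resolvents_krylov]): T - a acts on N(b) as the
    scalar b - a modulo E, so it is onto N(s) modulo E when a is not in s.
    Hence the dimension of N(s) + K_i depends only on size s + i, and the cases
    i = 0 and s empty give the theorem ([dim_resolvents]).

    Real subspaces are compared with complex ones through [cplx], which
    preserves dimensions, sums and images. *)

(** * Preimages under T - a and Krylov subspaces *)

Section Krylov.
Context (K : fieldType) (vT : vectType K).
Implicit Types (f : 'End(vT)) (X Y Z E : {vspace vT}) (a : K) (s : seq K).

(** The preimage of Z in X maps onto Z \cap f X with the same kernel as X, and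
    Z + f X = X says that f X misses exactly dim (X \cap ker f) dimensions
    of Z. *)
Lemma dim_preimv f X Z : (Z <= X)%VS -> (f @: X <= X)%VS ->
  (X <= Z + f @: X)%VS -> \dim (X :&: f @^-1: Z)%VS = \dim Z.
Proof.
move=> ZX fX XZ; have XE : (Z + f @: X)%VS = X.
  by apply/eqP; rewrite eqEsubv subv_add ZX fX.
have imE : (f @: (X :&: f @^-1: Z))%VS = (Z :&: f @: X)%VS.
  apply/vspaceP => y; apply/memv_imgP/memv_capP.
    by case=> x /memv_capP[xX]; rewrite -memv_preim => fxZ ->; rewrite memv_img.
  case=> yZ /memv_imgP[x xX yE]; exists x => //.
  by rewrite memv_cap xX -memv_preim -yE.
have kerE : (X :&: f @^-1: Z :&: lker f)%VS = (X :&: lker f)%VS.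
  apply/vspaceP => x; rewrite !memv_cap -memv_preim memv_ker.
  by case: eqP => [->|]; rewrite ?mem0v ?andbT ?andbF.
have := limg_ker_dim f X; have := limg_ker_dim f (X :&: f @^-1: Z).
by have := dimv_sum_cap Z (f @: X); rewrite imE kerE XE; lia.
Qed.

(** The map induced by f on the finite-dimensional X / Y is injective, hence
    onto; stated without forming the quotient. *)
Lemma injective_mod_cover f X Y : (Y <= X)%VS -> (f @: X <= X)%VS ->
    (f @: Y <= Y)%VS -> (forall x, x \in X -> f x \in Y -> x \in Y) ->
  (X <= Y + f @: X)%VS.
Proof.
move=> YX fX fY inj.
have imE : (Y :&: f @: X)%VS = (f @: Y)%VS.
  apply/vspaceP => y; apply/memv_capP/memv_imgP.
    by case=> yY /memv_imgP[x xX yE]; exists x => //; apply: inj; rewrite -?yE.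
  case=> x xY ->; split; first by rewrite (subvP fY) ?memv_img.
  by rewrite memv_img ?(subvP YX).
have kerE : (X :&: lker f)%VS = (Y :&: lker f)%VS.
  apply/vspaceP => x; rewrite !memv_cap memv_ker.
  case: eqP => [fx|]; rewrite ?andbT ?andbF //.
  by apply/idP/idP => [xX|/(subvP YX)//]; apply: inj; rewrite ?fx ?mem0v.
have sumX : (Y + f @: X <= X)%VS by rewrite subv_add YX.
rewrite -(geq_leqif (dimv_leqif_sup sumX)).
have := limg_ker_dim f X; have := limg_ker_dim f Y.
have := dimv_sum_cap Y (f @: X); rewrite imE kerE. lia.
Qed.

Definition shift f a : 'End(vT) := f - a *: \1%VF.

Lemma shiftE f a x : shift f a x = f x - a *: x.
Proof. by rewrite add_lfunE opp_lfunE scale_lfunE id_lfunE. Qed.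

Lemma shift_invariant f a X : (f @: X <= X)%VS -> (shift f a @: X <= X)%VS.
Proof.
move=> fX; apply/subvP => _ /memv_imgP[x xX ->]; rewrite shiftE.
by rewrite memvB ?memvZ //; apply: subvP fX _ (memv_img f xX).
Qed.

Definition krylov f E (i : nat) : {vspace vT} :=
  iter i (fun Y => f @: Y + E)%VS 0%VS.

Lemma krylovS f E i : krylov f E i.+1 = (f @: krylov f E i + E)%VS.
Proof. by []. Qed.

Lemma krylov_mono f E i : (krylov f E i <= krylov f E i.+1)%VS.
Proof.
elim: i => [|i IHi]; first exact: sub0v.
by rewrite !krylovS addvS ?limgS.
Qed.

Lemma krylov_sub f E X i : (f @: X <= X)%VS -> (E <= X)%VS ->
  (krylov f E i <= X)%VS.
Proof.
move=> fX EX; elim: i => [|i IHi]; first exact: sub0v.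
by rewrite krylovS subv_add EX (subv_trans (limgS f IHi)).
Qed.

(** Each term f x differs from (f - a) x by a multiple of x, which lies in an
    earlier Krylov subspace. *)
Lemma krylov_shift f a E i : krylov (shift f a) E i = krylov f E i.
Proof.
have sub g b : (krylov (shift g b) E i <= krylov g E i)%VS.
  elim: i => [|i IHi] //; rewrite krylovS subv_add [X in _ && X]addvSr andbT.
  apply/subvP => _ /memv_imgP[x /(subvP IHi) xK ->].
  rewrite shiftE memvB ?memvZ //; last exact: subvP (krylov_mono _ _ _) _ xK.
  by apply: subvP (addvSl _ _) _ _; rewrite memv_img.
have unshift : f = shift (shift f a) (- a).
  by apply/lfunP => x; rewrite !shiftE scaleNr opprK subrK.
by apply/eqP; rewrite eqEsubv sub {1}unshift sub.
Qed.

(** f commutes with f - a, and f e = (f - a) e + a e for e in E. *)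
Lemma shift_cover f X E a : (f @: X <= X)%VS -> (E <= X)%VS ->
    (f @: (E + shift f a @: X) <= E + shift f a @: X)%VS.
Proof.
move=> fX EX; apply/subvP => _ /memv_imgP[x /memv_addP[e eE [y yX ->]] ->].
have -> : f (e + y) = a *: (e + y) + shift f a (e + y).
  by rewrite shiftE [RHS]addrC subrK.
rewrite memvD ?memvZ ?memv_add //.
apply: subvP (addvSr _ _) _ (memv_img _ _); rewrite memvD //.
  exact: subvP EX _ eE.
exact: subvP (shift_invariant a fX) _ yX.
Qed.

(** For f - a invertible on X this is (f - a)^-1 E, the image of E under the
    resolvent of f at a. *)
Definition resolvent f X E a : {vspace vT} := (X :&: shift f a @^-1: E)%VS.

Lemma mem_resolvent f X E a x :
  (x \in resolvent f X E a) = (x \in X) && (f x - a *: x \in E).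
Proof. by rewrite memv_cap -memv_preim shiftE. Qed.

Definition resolvents f X E s : {vspace vT} :=
  (\sum_(a <- s) resolvent f X E a)%VS.

Lemma resolvents_cons f X E a s :
  resolvents f X E (a :: s) = (resolvent f X E a + resolvents f X E s)%VS.
Proof. exact: big_cons. Qed.

Lemma resolvents_sub f X E s : (resolvents f X E s <= X)%VS.
Proof.
elim: s => [|a s IHs]; first by rewrite /resolvents big_nil sub0v.
by rewrite resolvents_cons subv_add capvSl.
Qed.

(** On the summand attached to b, f - a is the scalar b - a modulo E. *)
Lemma shift_resolvents f X E s a x : x \in resolvents f X E s ->
  shift f a x \in (resolvents f X E s + E)%VS.
Proof.
elim: s x => [|b s IHs] x.
  by rewrite /resolvents big_nil add0v memv0 => /eqP->; rewrite linear0 mem0v.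
rewrite resolvents_cons => /memv_addP[y yb [z /IHs zs ->]].
rewrite linearD /= -addvA memvD //; last by rewrite (subvP (addvSr _ _)).
have := yb; rewrite mem_resolvent => /andP[_ yE].
have -> : shift f a y = (b - a) *: y + (f y - b *: y).
  by rewrite shiftE scalerBl [RHS]addrC addrA subrK.
by rewrite memv_add ?memvZ // (subvP (addvSr _ _)).
Qed.

(** Since b - a is nonzero for b in s, dividing each component by it inverts
    f - a modulo E. *)
Lemma resolvents_lift f X E s a x : a \notin s -> x \in resolvents f X E s ->
  exists2 y, y \in resolvents f X E s & shift f a y - x \in E.
Proof.
elim: s x => [|b s IHs] x.
  rewrite /resolvents big_nil memv0 => _ /eqP->; exists 0; first exact: mem0v.
  by rewrite linear0 subrr mem0v.
rewrite inE negb_or resolvents_cons => /andP[ab /IHs lift].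
case/memv_addP=> y yb [t /lift[z zs zE] ->].
have yE : f y - b *: y \in E by move: yb; rewrite mem_resolvent => /andP[].
have ba : b - a != 0 by rewrite subr_eq0 eq_sym.
exists ((b - a)^-1 *: y + z); first by rewrite memv_add ?memvZ.
rewrite linearD /= opprD addrACA memvD //.
have -> : shift f a ((b - a)^-1 *: y) - y = (b - a)^-1 *: (f y - b *: y).
  rewrite linearZ /= shiftE.
  by rewrite -[X in _ - X](scalerK ba) -scalerBr scalerBl opprB addrA subrK.
exact: memvZ.
Qed.

(** The exchange step: pulling back by f - a trades one Krylov power for the
    summand attached to a.  An x in the preimage is corrected by an element of
    the old resolvents, then by an element of the Krylov subspace of order i,
    after which (f - a) x lies in E. *)
Lemma preim_resolvents_krylov f X E s a i : a \notin s ->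
    (f @: X <= X)%VS -> (E <= X)%VS ->
  (X :&: shift f a @^-1: (resolvents f X E s + krylov f E i.+1))%VS =
  (resolvents f X E (a :: s) + krylov f E i)%VS.
Proof.
move=> as_ fX EX; apply/eqP; rewrite eqEsubv; apply/andP; split; last first.
  rewrite resolvents_cons !subv_add !subv_cap capvSl resolvents_sub.
  rewrite krylov_sub // -andbA; apply/and3P; split; apply/subvP => x.
  - rewrite -memv_preim mem_resolvent -shiftE => /andP[_ xE].
    by rewrite (subvP (addvSr _ _)) // krylovS (subvP (addvSr _ _)).
  - move=> /(@shift_resolvents _ _ _ _ a) xE; rewrite -memv_preim.
    by apply: subvP xE; rewrite addvS // krylovS addvSr.
  - move=> xK; rewrite -memv_preim (subvP (addvSr _ _)) //.
    rewrite -(krylov_shift f a) krylovS (subvP (addvSl _ _)) //.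
    by rewrite memv_img // krylov_shift.
apply/subvP => x; rewrite memv_cap -memv_preim -(krylov_shift f a) krylovS.
rewrite krylov_shift => /andP[xX /memv_addP[y /(resolvents_lift as_)[z zs zE]]].
case=> _ /memv_addP[_ /memv_imgP[k kK ->] [e eE ->]] fx.
have -> : x = (x - z - k) + z + k by rewrite addrAC !subrK.
rewrite resolvents_cons !memv_add //.
rewrite mem_resolvent -shiftE !linearB /= fx; apply/andP; split.
  rewrite !memvB //; first exact: subvP (resolvents_sub _ _ _ _) _ zs.
  exact: subvP (krylov_sub i fX EX) _ kK.
have -> : y + (shift f a k + e) - shift f a z - shift f a k =
          e - (shift f a z - y).
  rewrite opprB [LHS]addrAC addrCA [_ + (y + e)]addrC addrK.
  by rewrite addrA [y + e]addrC.
exact: memvB.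
Qed.

(** The Krylov summand in the auxiliary claim is what lets the exchange step be
    iterated: each step removes one point of s and raises the order by one. *)
Lemma dim_resolvents f X E s : uniq s -> (f @: X <= X)%VS -> (E <= X)%VS ->
    (forall a, a \in s -> (X <= E + shift f a @: X)%VS) ->
  \dim (resolvents f X E s) = \dim (krylov f E (size s)).
Proof.
move=> us fX EX cover.
suff dimE i : \dim (resolvents f X E s + krylov f E i)%VS =
              \dim (krylov f E (size s + i)).
  by have := dimE 0; rewrite addv0 addn0.
elim: s us cover i => [_ _ i|a s IHs /andP[as_ us] cover i].
  by rewrite /resolvents big_nil add0v.
rewrite addSnnS -IHs //; last first.
  by move=> b bs; apply: cover; rewrite inE bs orbT.
rewrite -preim_resolvents_krylov // dim_preimv ?shift_invariant //.
  by rewrite subv_add resolvents_sub krylov_sub.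
apply: subv_trans (cover a (mem_head a s)) _.
by rewrite addvS // krylovS addvA addvSr.
Qed.

End Krylov.

(** * Column spaces *)


Section ColumnSpace.
Context (K : fieldType).

Lemma cmulE q r (M : 'M[K]_(r, q)) x : cmul M x = M *m x.
Proof. exact: lfunE. Qed.

Lemma memv_colspan q r (M : 'M[K]_(r, q)) y :
  reflect (exists x, y = M *m x) (y \in limg (cmul M)).
Proof.
apply: (iffP memv_imgP) => [[x _ ->]|[x ->]]; exists x; rewrite ?cmulE //.
exact: memvf.
Qed.

(** The rank factorization of M gives its image as that of an injective map. *)
Lemma dim_colspan q r (M : 'M[K]_(r, q)) : \dim (limg (cmul M)) = \rank M.
Proof.
have -> : limg (cmul M) = limg (cmul (col_base M)).
  apply/vspaceP => y; apply/memv_colspan/memv_colspan => -[x ->].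
    by exists (row_base M *m x); rewrite mulmxA mulmx_base.
  exists (pinvmx (row_base M) *m x).
  rewrite -[X in X *m (_ *m _)](mulmx_base M) -mulmxA (mulmxA (row_base M)).
  by rewrite mulmxVp ?row_base_free // mul1mx.
rewrite limg_dim_eq; first by rewrite dimvf; exact: muln1.
apply/eqP; rewrite -subv0; apply/subvP => x /memv_capP[_].
rewrite memv_ker cmulE memv0 => /eqP Mx0.
by rewrite -[x]mul1mx -(mulVpmx (col_base_full M)) -mulmxA Mx0 mulmx0.
Qed.

Lemma colspan_mxrow r h (k : 'I_h -> nat) (M : forall i, 'M[K]_(r, k i)) :
  limg (cmul (\mxrow_(i < h) M i)) = (\sum_(i < h) limg (cmul (M i)))%VS.
Proof.
apply/vspaceP => y; apply/memv_colspan/memv_sumP => [[x ->]|[ys ysM ->]].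
  exists (fun i => M i *m submxcol x i).
    by move=> i _; apply/memv_colspan; exists (submxcol x i).
  by rewrite -mul_mxrow_mxcol submxcolK.
have /fin_all_exists[x xE] i : exists x, ys i = M i *m x.
  exact/memv_colspan/ysM.
exists (\mxcol_i x i); rewrite mul_mxrow_mxcol.
by apply: eq_bigr.
Qed.

Lemma basis_mx_limg q k (U : {vspace 'cV[K]_q}) (M : 'M[K]_(q, k)) :
  basis_mx U M -> U = limg (cmul M).
Proof.
move=> /span_basis <-; apply/eqP; rewrite eqEsubv; apply/andP; split.
  apply/span_subvP => _ /mapP[j _ ->]; apply/memv_colspan.
  by exists (delta_mx j 0); rewrite colE.
apply/subvP => _ /memv_colspan[x ->].
have -> : M *m x = \sum_j x j 0 *: col j M.
  apply/colP => i; rewrite mxE summxE; apply: eq_bigr => j _.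
  by rewrite !mxE mulrC.
rewrite memv_suml // => j _; rewrite memvZ // memv_span //.
by apply/mapP; exists j => //; rewrite val_ord_tuple mem_enum.
Qed.

End ColumnSpace.

(** * Complexification of real subspaces *)

Section Complexification.
Context (R : realType).

Notation Rev := (map_mx (@complex.Re R)).
Notation Imv := (map_mx (@complex.Im R)).
Notation cplxmx := (map_mx (real_complex R)).

Definition cplxv q (x y : 'cV[R]_q) : 'cV[R[i]]_q :=
  \col_j (x j 0 +i* y j 0).

Lemma Re_cplxv q (x y : 'cV[R]_q) : Rev (cplxv x y) = x.
Proof. by apply/colP => j; rewrite !mxE. Qed.

Lemma Im_cplxv q (x y : 'cV[R]_q) : Imv (cplxv x y) = y.
Proof. by apply/colP => j; rewrite !mxE. Qed.

Lemma eq_cplx q (x y : 'cV[R[i]]_q) : Rev x = Rev y -> Imv x = Imv y -> x = y.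
Proof.
move=> /colP rxy /colP ixy; apply/colP => j.
move: (rxy j) (ixy j); rewrite !mxE.
by case: (x j 0) (y j 0) => [a b] [c d] /= -> ->.
Qed.

(** The complex matrix of a real projector onto V has the complexification of V
    as its image; its rank is the real rank, which gives the dimension at
    once. *)
Definition cplx q (V : {vspace 'cV[R]_q}) : {vspace 'cV[R[i]]_q} :=
  limg (cmul (cplxmx (mx_of_end (projv V)))).

Lemma mem_cplx q (V : {vspace 'cV[R]_q}) x :
  (x \in cplx V) = in_complexification V x.
Proof.
apply/memv_colspan/andP => [[y ->]|[rV iV]].
  by rewrite Re_mulmx Im_mulmx !mx_of_endE !memv_proj.
by exists x; apply: eq_cplx; rewrite ?Re_mulmx ?Im_mulmx mx_of_endE projv_id.
Qed.

Lemma mem_cplxv q (V : {vspace 'cV[R]_q}) x y :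
  x \in V -> y \in V -> cplxv x y \in cplx V.
Proof.
by move=> xV yV; rewrite mem_cplx /in_complexification Re_cplxv Im_cplxv xV.
Qed.

Lemma dim_cplx q (V : {vspace 'cV[R]_q}) : \dim (cplx V) = \dim V.
Proof.
rewrite dim_colspan mxrank_map -dim_colspan -[in RHS](limg_proj V).
by congr (\dim (_ @: _)%VS); apply/lfunP => x; rewrite cmulE mx_of_endE.
Qed.

Lemma cplxS q (V W : {vspace 'cV[R]_q}) : (V <= W)%VS -> (cplx V <= cplx W)%VS.
Proof.
move=> /subvP VW; apply/subvP => x; rewrite !mem_cplx => /andP[/VW rx /VW ix].
exact/andP.
Qed.

Lemma cplx0 q : cplx (0 : {vspace 'cV[R]_q}) = 0%VS.
Proof. by apply/eqP; rewrite -dimv_eq0 dim_cplx dimv0. Qed.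

Lemma cplxD q (V W : {vspace 'cV[R]_q}) :
  cplx (V + W)%VS = (cplx V + cplx W)%VS.
Proof.
apply/eqP; rewrite eqEsubv; apply/andP; split; last first.
  by rewrite subv_add !cplxS ?addvSl ?addvSr.
apply/subvP => x; rewrite mem_cplx.
move=> /andP[/memv_addP[v vV [w wW rE]] /memv_addP[v' vV' [w' wW' iE]]].
have -> : x = cplxv v v' + cplxv w w'.
  by apply: eq_cplx; rewrite ?rE ?iE; apply/colP => j; rewrite !mxE.
by rewrite memv_add ?mem_cplxv.
Qed.

Lemma cplx_img q r (M : 'M[R]_(r, q)) (V : {vspace 'cV[R]_q}) :
  cplx (cmul M @: V)%VS = (cmul (cplxmx M) @: cplx V)%VS.
Proof.
apply/vspaceP => y; rewrite mem_cplx; apply/andP/memv_imgP; last first.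
  case=> x; rewrite mem_cplx => /andP[rV iV] ->.
  by rewrite cmulE Re_mulmx Im_mulmx -!cmulE !memv_img.
case=> /memv_imgP[a aV rE] /memv_imgP[b bV iE].
exists (cplxv a b); first exact: mem_cplxv.
by apply: eq_cplx; rewrite cmulE ?Re_mulmx ?Im_mulmx ?Re_cplxv ?Im_cplxv -cmulE.
Qed.

Lemma cplx_krylov q (M : 'M[R]_q) (E : {vspace 'cV[R]_q}) i :
  cplx (krylov (cmul M) E i) = krylov (cmul (cplxmx M)) (cplx E) i.
Proof.
by elim: i => [|i IHi]; rewrite ?cplx0 // !krylovS cplxD cplx_img IHi.
Qed.

(** A subspace W that is least among the real M-invariant subspaces containing E
    stays least among the complex ones: the real subspaces whose
    complexification lies in Y have a largest member, and it is M-invariant and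
    contains E. *)
Lemma cplx_min q (M : 'M[R]_q) (E W : {vspace 'cV[R]_q}) Y :
    (forall U, (cmul M @: U <= U)%VS /\ (E <= U)%VS -> (W <= U)%VS) ->
    (cmul (cplxmx M) @: Y <= Y)%VS -> (cplx E <= Y)%VS ->
  (cplx W <= Y)%VS.
Proof.
move=> Wmin MY EY.
pose inY U := (cplx U <= Y)%VS.
have [UY Umax] : is_largest inY (largest inY).
  apply: (largestP EY); rewrite /inY => U U' UY UY'.
  by rewrite cplxD subv_add UY.
apply: subv_trans (UY); apply/cplxS/Wmin; split; apply: Umax => //.
rewrite /inY cplx_img; apply: subv_trans (limgS _ UY) MY.
Qed.

End Complexification.

(** * The system restricted to its largest output-nulling subspace *)


Section System.
Context (R : realType) (n m p : nat).
Context (A : 'M[R]_n) (B : 'M[R]_(n, m)) (C : 'M[R]_(p, n)) (D : 'M[R]_(p, m)).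
Context (F : 'M[R]_(m, n)).

Notation Rev := (map_mx (@complex.Re R)).
Notation Imv := (map_mx (@complex.Im R)).
Notation cplxmx := (map_mx (real_complex R)).
Notation V := (vstar A B C D).
Notation E := (V :&: (cmul B @: lker (cmul D)))%VS.
Notation T := (cplxmx (A + B *m F)).

Hypothesis VF : friend A B C D V F.

(** The inputs u may be chosen on the columns of a projector onto W; the matrix
    with these inputs as columns is then a friend of W. *)
Lemma vstar_max (W : {vspace 'cV[R]_n}) :
    (forall x, x \in W ->
       exists u, A *m x + B *m u \in W /\ C *m x + D *m u = 0) ->
  (W <= V)%VS.
Proof.
move=> Wu; have [_ Vmax] := vstarP A B C D; apply: Vmax.
pose P := mx_of_end (projv W).
have Wcol j : col j P \in W by rewrite colE mx_of_endE memv_proj.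
have /fin_all_exists[u uP] j : exists u,
    A *m col j P + B *m u \in W /\ C *m col j P + D *m u = 0.
  exact/Wu/Wcol.
pose G : 'M[R]_(m, n) := \matrix_(i, j) u j i 0.
have GE q (M : 'M[R]_(q, n)) (N : 'M[R]_(q, m)) x : x \in W ->
    (M + N *m G) *m x = \sum_j x j 0 *: (M *m col j P + N *m u j).
  move=> xW; have Px : P *m x = x by rewrite mx_of_endE projv_id.
  have sumE r (H : 'M[R]_(r, n)) : H *m x = \sum_j x j 0 *: col j H.
    apply/colP => i; rewrite mxE summxE; apply: eq_bigr => j _.
    by rewrite !mxE mulrC.
  rewrite mulmxDl -{1}Px -!mulmxA (sumE _ P) (sumE _ G) !mulmx_sumr -big_split.
  apply: eq_bigr => j _; rewrite /= -!scalemxAr -scalerDr.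
  by congr (_ *: (_ + _ *m _)); apply/colP => i; rewrite !mxE.
exists G; apply/friendP => x xW; rewrite !GE //; split.
  by rewrite memv_suml // => j _; rewrite memvZ //; case: (uP j).
by rewrite big1 // => j _; have [_ ->] := uP j; rewrite scaler0.
Qed.

Lemma friend_vstar x : x \in V ->
  ((A + B *m F) *m x \in V) /\ (C + D *m F) *m x = 0.
Proof. exact: (friendP _ _ _ _ _ _ VF). Qed.

(** V* + <x> satisfies the pointwise criterion of [vstar_max]. *)
Lemma vstar_pred x u : A *m x + B *m u \in V -> C *m x + D *m u = 0 -> x \in V.
Proof.
move=> yV C0.
have /subvP VW : (V + <[x]> <= V)%VS.
  apply: vstar_max => _ /memv_addP[v vV [_ /vlineP[c ->] ->]].
  have [AvV Cv0] := friend_vstar vV.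
  exists (F *m v + c *: u); split.
    have -> : A *m (v + c *: x) + B *m (F *m v + c *: u) =
              (A + B *m F) *m v + c *: (A *m x + B *m u).
      by rewrite !mulmxDr mulmxDl scalerDr -!scalemxAr mulmxA addrACA.
    by rewrite (subvP (addvSl _ _)) // memvD ?memvZ.
  have -> : C *m (v + c *: x) + D *m (F *m v + c *: u) =
            (C + D *m F) *m v + c *: (C *m x + D *m u).
    by rewrite !mulmxDr mulmxDl scalerDr -!scalemxAr mulmxA addrACA.
  by rewrite Cv0 C0 scaler0 addr0.
by apply: VW; rewrite (subvP (addvSr _ _)) // memv_line.
Qed.

(** The difference is B (u - F x), and u - F x lies in ker D because D u and
    D F x both cancel C x. *)
Lemma friend_step x u : x \in V -> A *m x + B *m u \in V ->
  C *m x + D *m u = 0 -> A *m x + B *m u - (A + B *m F) *m x \in E.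
Proof.
move=> xV yV C0; have [AxV Cx0] := friend_vstar xV.
rewrite memv_cap memvB //=; apply/memv_imgP; exists (u - F *m x).
  rewrite memv_ker cmulE mulmxBr mulmxA.
  have /addrI -> : C *m x + D *m F *m x = C *m x + D *m u.
    by rewrite C0 -mulmxDl.
  by rewrite subrr.
by rewrite cmulE mulmxDl mulmxBr mulmxA opprD addrACA subrr add0r.
Qed.

Lemma sseqSP i y : reflect
  (exists x u, [/\ x \in sseq A B C D i, C *m x + D *m u = 0 &
                   y = A *m x + B *m u])
  (y \in sseq A B C D i.+1).
Proof.
apply: (iffP memv_imgP) => [[z /memv_capP[zS]]|[x [u [xS C0 ->]]]].
  case/memv_addP: zS => _ /memv_imgP[x xS ->] [_ /memv_imgP[u _ ->] ->].
  rewrite !cmulE !mul_col_mx !mul0mx !mul1mx add_col_mx addr0 add0r.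
  rewrite memv_ker cmulE !mul_row_col => /eqP C0 ->.
  by exists x, u.
exists (col_mx x u); last by rewrite cmulE mul_row_col.
rewrite memv_cap memv_ker cmulE mul_row_col C0 eqxx andbT.
apply/memv_addP; exists (cmul (col_mx 1%:M 0) x); first exact: memv_img.
exists (cmul (col_mx 0 1%:M) u); first by rewrite memv_img ?memvf.
by rewrite !cmulE !mul_col_mx !mul0mx !mul1mx add_col_mx addr0 add0r.
Qed.

Lemma vstar_cap_sseq i :
  (V :&: sseq A B C D i)%VS = krylov (cmul (A + B *m F)) E i.
Proof.
elim: i => [|i IHi]; first by rewrite capv0.
rewrite krylovS -IHi; apply/vspaceP => y; apply/idP/idP.
  case/memv_capP=> yV /sseqSP[x [u [xS C0 yE]]]; rewrite {}yE in yV *.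
  have xV := vstar_pred yV C0.
  rewrite -[A *m x + B *m u](subrKC ((A + B *m F) *m x)).
  rewrite memv_add ?friend_step // -cmulE memv_img // memv_cap xV.
  exact: xS.
case/memv_addP=> _ /memv_imgP[x /memv_capP[xV xS] ->] [e /memv_capP[eV]].
case/memv_imgP=> w; rewrite memv_ker !cmulE => /eqP Dw0 eE ->.
have [AxV Cx0] := friend_vstar xV.
rewrite memv_cap memvD //=; apply/sseqSP; exists x, (F *m x + w); split=> //.
  by rewrite mulmxDr Dw0 addr0 mulmxA -mulmxDl.
by rewrite eE mulmxDl mulmxDr mulmxA addrA.
Qed.

Lemma rosenbrock_ker lam (x : 'cV_n) (u : 'cV_m) :
  rosenbrock A B C D lam *m col_mx x u = 0 <->
  cplxmx A *m x + cplxmx B *m u = lam *: x /\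
  cplxmx C *m x + cplxmx D *m u = 0.
Proof.
rewrite mul_block_col mulmxBl mul_scalar_mx addrAC; split.
  move/eqP; rewrite col_mx_eq0 => /andP[/eqP/subr0_eq ? /eqP ?]; by split.
by case=> -> ->; rewrite subrr col_mx0.
Qed.

(** A kernel vector gives x in V* because the real span of Re x and Im x is
    output-nulling: multiplication by lam preserves it.  Conversely, if
    T x - lam x = B w with D w = 0, then u = F x - w completes x to a kernel
    vector. *)
Lemma mem_resolvent_rosenbrock lam (x : 'cV_n) :
  x \in resolvent (cmul T) (cplx V) (cplx E) lam <->
  exists u, rosenbrock A B C D lam *m col_mx x u = 0.
Proof.
rewrite mem_resolvent cmulE; split=> [/andP[xV xE]|[u]].
  have /memv_imgP[w] :
      T *m x - lam *: x \in (cmul (cplxmx B) @: cplx (lker (cmul D)))%VS.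
    by rewrite -cplx_img; apply: subvP xE; apply: cplxS; apply: capvSr.
  rewrite mem_cplx !cmulE => /andP[].
  rewrite !memv_ker !cmulE => /eqP rD /eqP iD wE.
  exists (cplxmx F *m x - w); apply/rosenbrock_ker; split.
    rewrite mulmxBr -wE mulmxA addrA -mulmxDl -map_mxM -map_mxD.
    by rewrite opprB addrC subrK.
  have -> : cplxmx D *m (cplxmx F *m x - w) = cplxmx D *m cplxmx F *m x.
    rewrite mulmxBr mulmxA.
    have -> : cplxmx D *m w = 0; last by rewrite subr0.
    apply: eq_cplx; rewrite ?Re_mulmx ?Im_mulmx ?rD ?iD;
      by apply/colP => j; rewrite !mxE.
  rewrite -mulmxDl -map_mxM -map_mxD.
  move: xV; rewrite mem_cplx => /andP[/friend_vstar[_ rC] /friend_vstar[_ iC]].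
  apply: eq_cplx; rewrite ?Re_mulmx ?Im_mulmx ?rC ?iC;
    by apply/colP => j; rewrite !mxE.
case/rosenbrock_ker => Ax C0.
have rA : A *m Rev x + B *m Rev u = Rev (lam *: x).
  by rewrite -Ax (map_mxD (@complex.Re R)) !Re_mulmx.
have iA : A *m Imv x + B *m Imv u = Imv (lam *: x).
  by rewrite -Ax (map_mxD (@complex.Im R)) !Im_mulmx.
have rC : C *m Rev x + D *m Rev u = 0.
  by rewrite -!Re_mulmx -(map_mxD (@complex.Re R)) C0 map_mx0.
have iC : C *m Imv x + D *m Imv u = 0.
  by rewrite -!Im_mulmx -(map_mxD (@complex.Im R)) C0 map_mx0.
pose W := (<[Rev x]> + <[Imv x]>)%VS.
have rW : Rev x \in W by rewrite (subvP (addvSl _ _)) // memv_line.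
have iW : Imv x \in W by rewrite (subvP (addvSr _ _)) // memv_line.
have rlW : Rev (lam *: x) \in W.
  have -> : Rev (lam *: x) = complex.Re lam *: Rev x - complex.Im lam *: Imv x.
    by apply/colP => j; rewrite !mxE; case: (lam) (x j 0) => a b [c d].
  by rewrite memvB ?memvZ.
have ilW : Imv (lam *: x) \in W.
  have -> : Imv (lam *: x) = complex.Re lam *: Imv x + complex.Im lam *: Rev x.
    by apply/colP => j; rewrite !mxE; case: (lam) (x j 0) => a b [c d].
  by rewrite memvD ?memvZ.
have /subvP WV : (W <= V)%VS.
  apply: vstar_max => _ /memv_addP[_ /vlineP[c ->] [_ /vlineP[d ->] ->]].
  exists (c *: Rev u + d *: Imv u).
  have comb r (M : 'M[R]_(r, n)) (N : 'M[R]_(r, m)) :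
    M *m (c *: Rev x + d *: Imv x) + N *m (c *: Rev u + d *: Imv u) =
    c *: (M *m Rev x + N *m Rev u) + d *: (M *m Imv x + N *m Imv u).
    by rewrite !mulmxDr !scalerDr -!scalemxAr addrACA.
  by rewrite !comb rA iA rC iC !scaler0 addr0 memvD ?memvZ.
rewrite !mem_cplx /in_complexification.
rewrite (map_mxB (@complex.Re R)) (map_mxB (@complex.Im R)).
rewrite Re_mulmx Im_mulmx !WV //= -rA -iA -memvN opprB.
by rewrite friend_step ?rA ?WV //= -memvN opprB friend_step ?iA ?WV.
Qed.

(** T - lam is onto modulo R*, and R* itself is reached because
    E + (T - lam) V* is T-invariant and contains E. *)
Lemma not_zero_cover lam : ~ invariant_zero A B C D lam ->
  (cplx V <= cplx E + shift (cmul T) lam @: cplx V)%VS.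
Proof.
move=> not_zero; have [[AR ER] Rmin] := reachP A B D V F.
set W := reach A B D V F in AR ER Rmin.
have RV : (W <= V)%VS by exact: reach_subv VF.
have AV : (cmul (A + B *m F) @: V <= V)%VS by case/andP: VF.
have TV : (cmul T @: cplx V <= cplx V)%VS by rewrite -cplx_img cplxS.
have TR : (cmul T @: cplx W <= cplx W)%VS by rewrite -cplx_img cplxS.
have VR : (cplx V <= cplx W + shift (cmul T) lam @: cplx V)%VS.
  apply: injective_mod_cover; rewrite ?cplxS ?shift_invariant // => x.
  rewrite shiftE cmulE !mem_cplx => xV xR.
  apply/negPn/negP => xW; apply: not_zero; exists F => //.
  by exists x.
apply: subv_trans VR _; rewrite subv_add addvSr andbT.
apply: (cplx_min Rmin); last exact: addvSl.
by apply: shift_cover; rewrite ?cplxS ?capvSl.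
Qed.

End System.

Theorem theorem3 (R : realType) (n m p : nat)
  (A : 'M[R]_n) (B : 'M[R]_(n, m)) (C : 'M[R]_(p, n)) (D : 'M[R]_(p, m))
  (h : nat) (lam : 'I_h -> R[i])
  (lam_distinct : injective lam)
  (lam_not_zero : forall i : 'I_h, ~ invariant_zero A B C D (lam i))
  (k : 'I_h -> nat)
  (V : forall i : 'I_h, 'M[R[i]]_(n, k i))
  (W : forall i : 'I_h, 'M[R[i]]_(m, k i))
  (VW_basis : forall i : 'I_h,
     basis_mx (lker (cmul (rosenbrock A B C D (lam i)))) (col_mx (V i) (W i))) :
  \rank (\mxrow_(i < h) V i) = \dim (vstar A B C D :&: sseq A B C D h)%VS.
Proof.
have [[F VF] _] := vstarP A B C D.
set X := vstar A B C D in VF *.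
pose E := (X :&: (cmul B @: lker (cmul D)))%VS.
pose T := map_mx (real_complex R) (A + B *m F).
rewrite (vstar_cap_sseq VF) -dim_cplx cplx_krylov.
have VE i : limg (cmul (V i)) = resolvent (cmul T) (cplx X) (cplx E) (lam i).
  have kerE := basis_mx_limg (VW_basis i).
  apply/vspaceP => x; apply/memv_colspan/idP => [[c ->]|].
    apply/(mem_resolvent_rosenbrock VF); exists (W i *m c).
    apply/eqP; rewrite -mul_col_mx -cmulE -memv_ker kerE.
    by apply/memv_colspan; exists c.
  case/(mem_resolvent_rosenbrock VF) => u /eqP; rewrite -cmulE -memv_ker kerE.
  by case/memv_colspan => c; rewrite mul_col_mx => /eq_col_mx[-> _]; exists c.
have resE : limg (cmul (\mxrow_(i < h) V i)) =
            resolvents (cmul T) (cplx X) (cplx E) [seq lam i | i <- enum 'I_h].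
  rewrite colspan_mxrow /resolvents big_map big_enum.
  by apply: eq_bigr => i _; rewrite VE.
have /andP[AX _] := VF.
rewrite -dim_colspan resE dim_resolvents.
- by rewrite size_map size_enum_ord.
- by rewrite map_inj_uniq ?enum_uniq.
- by rewrite -cplx_img cplxS.
- by rewrite cplxS ?capvSl.
- by move=> _ /mapP[i _ ->]; apply: not_zero_cover.
Qed.
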